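(* Let $k\ge 1$ be an integer and let $c_0^k(n,\ell)$ be the number of $k$-compositions of $n$ with exactly $\ell$ zeros. Then for all $n\ge 2$ and $\ell\ge 0$, $$c_0^k(n,\ell)=c_0^k(n-1,\ell-k+1)+\cdots+c_0^k(n-1,\ell-1)+2c_0^k(n-1,\ell),$$ that is, $c_0^k(n,\ell)=2c_0^k(n-1,\ell)+\sum_{j=1}^{k-1}c_0^k(n-1,\ell-j)$; and for all $n\ge 1$ and $\ell\ge 0$, $$c_0^k(n,\ell)=\sum_{m=0}^{n-1}\binom{n-1}{m}\binom{m}{\ell}_{k-1}.$$
   Context: For positive integers $k$ and $n$, a $k$-composition of $n$ (internal-zeros form) is an ordered sequence of positive integers with sum $n$ in which, in addition, each positive part except the first may be immediately preceded by up to $k-1$ zeros. Equivalently, it is a finite sequence of nonnegative integers with sum $n$ whose first and last entries are positive and with at most $k-1$ zeros between any two successive positive entries. Put $c_0^k(n,\ell)=0$ when $\ell<0$. The multinomial (polynomial) coefficient is $\binom{n}{\ell}_r=[x^\ell](1+x+\cdots+x^r)^n$, the coefficient of $x^\ell$ in that polynomial (for $r=0$ the polynomial is $1$). *)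

(* Defs.v *)
From mathcomp Require Import all_boot all_algebra finmap.
From mathcomp Require Import zify.
From mathcomp Require Import boolp classical_sets cardinality.

Set Implicit Arguments.
Unset Strict Implicit.
Unset Printing Implicit Defensive.

Local Open Scope nat_scope.

(* The entries at positions i < j are successive positive entries of s: both
   are positive, and every entry strictly between them is zero. *)
Definition successive_parts (s : seq nat) (i j : nat) : Prop :=
  [/\ i < j < size s, 0 < nth 0 s i, 0 < nth 0 s j &
      forall m, i < m < j -> nth 0 s m = 0].

(* The default value 0 of head and last excludes the empty sequence. *)
Definition kcomposition (k n : nat) (s : seq nat) : Prop :=
  [/\ sumn s = n, 0 < head 0 s, 0 < last 0 s &
      forall i j, successive_parts s i j -> j - i - 1 <= k - 1].

Definition kcompositions_zeros (k n l : nat) : set (seq nat) :=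
  [set s | kcomposition k n s /\ count_mem 0 s = l]%classic.

(* fset_set sends infinite sets to the empty fset, so the cardinals below are
   meaningful because of this lemma. *)
Lemma finite_kcompositions_zeros k n l :
  finite_set (kcompositions_zeros k n l).
Proof.
pose f (p : 'I_(n + l).+1 * (n + l).-tuple 'I_n.+1) : seq nat :=
  take p.1 (map val p.2).
apply: (@sub_finite_set _ _ (range f)); last first.
  exact/finite_image/finite_finset.
move=> s [[sn _ _ _] sl].
have le_size : size s <= n + l.
  rewrite -sn -sl; elim: s {sn sl} => //= x s IHs.
  by case: x => [|x] /=; lia.
have le_sum x : x \in s -> x < n.+1.
  rewrite ltnS -sn; elim: s {sn sl le_size} => //= y s IHs.
  rewrite inE => /orP[/eqP->|/IHs]; lia.
have sz : size (map (inord : nat -> 'I_n.+1) s ++ nseq (n + l - size s) ord0)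
  == n + l by rewrite size_cat size_map size_nseq subnKC.
exists (Ordinal (le_size : size s < (n + l).+1), Tuple sz) => //.
rewrite /f /= map_cat take_size_cat ?size_map // -map_comp -[RHS]map_id.
by apply/eq_in_map => x /le_sum xn /=; rewrite inordK.
Qed.

Definition c0 (k n : nat) (l : int) : nat :=
  match l with
  | Posz l => #|` fset_set (kcompositions_zeros k n l)|
  | Negz _ => 0
  end.

Definition polynomial_coef (n l r : nat) : nat :=
  (((\sum_(i < r.+1) 'X^i : {poly nat}) ^+ n)`_l)%R.

(* Main.v *)
Require Import Defs.
From mathcomp Require Import all_boot all_algebra finmap.
From mathcomp Require Import zify.
From mathcomp Require Import boolp classical_sets cardinality.

(** Adding 1 to the first part, or prepending a new first part 1 followed by
j < k zeros, turns every k-composition of n >= 1 into a k-composition of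
n + 1, and every k-composition of n + 1 arises exactly once in this way:
whether its first part is 1 decides which of the two operations was used, and
in the second case j is the number of zeros that follow that first part.  The
first operation keeps the number of zeros and the second increases it by j, so
the polynomials P_n whose coefficient at 'X^l is c0 k n l satisfy P_1 = 1 and
  P_(n+1) = (1 + Q) P_n, where Q = 1 + 'X + ... + 'X^(k-1).
Reading off coefficients in this equation yields the recurrence, the factor 2
coming from the terms 1 and 'X^0 of 1 + Q.  Expanding P_n = (1 + Q)^(n-1) by
the binomial theorem yields the closed formula.

The bijection is expressed by the duplicate-free list [compositions k n], built
by the two operations, whose members are the k-compositions of n + 1
([mem_compositions], [uniq_compositions]); P_(n+1) is [zeros_poly k n]. *)

Import GRing.Theory.

Local Open Scope nat_scope.

(** * Two ways to enlarge a k-composition *)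

Definition prepend_one (j : nat) (s : seq nat) : seq nat :=
  1 :: nseq j 0 ++ s.

Lemma nth_prepend_one j s m :
  nth 0 (prepend_one j s) m =
  if m == 0 then 1 else if m <= j then 0 else nth 0 s (m - j.+1).
Proof.
case: m => [//|m] /=; rewrite nth_cat size_nseq nth_nseq subSS.
by case: ltnP.
Qed.

(** Only the sum sees the difference between two positive first parts. *)
Lemma kcomposition_incr_head k n x s :
  kcomposition k n.+1 (x.+2 :: s) <-> kcomposition k n (x.+1 :: s).
Proof.
(* The gap condition sees only which entries vanish. *)
have nth_eq0 m : (nth 0 (x.+2 :: s) m == 0) = (nth 0 (x.+1 :: s) m == 0).
  by case: m.
have succE i j : successive_parts (x.+2 :: s) i j <->
                 successive_parts (x.+1 :: s) i j.
  rewrite /successive_parts !lt0n !nth_eq0.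
  split=> -[? ? ? zs]; split=> // m /zs /eqP.
    by rewrite nth_eq0 => /eqP.
  by rewrite -nth_eq0 => /eqP.
have lastE : (0 < last 0 (x.+2 :: s)) = (0 < last 0 (x.+1 :: s)).
  by case: s {nth_eq0 succE}.
rewrite /kcomposition lastE /=.
split=> -[sn _ ls gap]; split=> //; try lia; move=> i j ij;
  by apply: gap; apply/succE.
Qed.

(** The gap between the new first part and the head of s consists of the j
inserted zeros, which is where j < k comes from; the other pairs of successive
parts are those of s, shifted by j + 1. *)
Lemma kcomposition_prepend_one k n j s : 0 < k -> 0 < head 0 s ->
  kcomposition k n.+1 (prepend_one j s) <-> j < k /\ kcomposition k n s.
Proof.
move=> k0 hs.
have lastE : last 0 (prepend_one j s) = last 0 s.
  by case: s hs => //= x s _; rewrite last_cat.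
have sumE : sumn (prepend_one j s) = (sumn s).+1.
  by rewrite /= sumn_cat sumn_nseq mul0n.
have sizeE : size (prepend_one j s) = j.+1 + size s.
  by rewrite /= size_cat size_nseq addSn.
have size_s : 0 < size s by case: s hs {lastE sumE sizeE}.
have nth_hd : nth 0 s 0 = head 0 s by case: s hs {lastE sumE sizeE size_s}.
split=> [[]|[jk []]]; rewrite /kcomposition lastE sumE.
- move=> [sn] _ ls gap; split.
    have : successive_parts (prepend_one j s) 0 j.+1.
      split; rewrite ?sizeE ?nth_prepend_one ?ltnn ?subnn ?nth_hd //=; first by lia.
      by move=> [|m] // mj; rewrite nth_prepend_one /= ifT //; lia.
    by move/gap; lia.
  split=> // a b [ab sa sb zab].
  have : successive_parts (prepend_one j s) (j.+1 + a) (j.+1 + b).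
    split; rewrite ?sizeE ?nth_prepend_one; first by lia.
    + by rewrite ifF ?ifF ?addKn //; lia.
    + by rewrite ifF ?ifF ?addKn //; lia.
    move=> m mab; rewrite nth_prepend_one ifF ?ifF; try lia.
    by apply: zab; lia.
  by move/gap; lia.
- move=> sn _ ls gap; split=> //; first by rewrite sn.
  move=> a b [ab]; rewrite sizeE in ab; rewrite !nth_prepend_one.
  case: eqP => [a0 _|a0].
    (* Position j.+1 holds the first part of s, so b cannot exceed it. *)
    move=> _ zab; case: (leqP b j.+1) => [|jb]; first by lia.
    have := zab j.+1; rewrite nth_prepend_one /= ltnn subnn nth_hd => hd0.
    by have := hd0 ltac:(lia); lia.
  case: (leqP a j) => // ja sa; rewrite ifF ?ifF; try lia.
  move=> sb zab; have : successive_parts s (a - j.+1) (b - j.+1).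
    split=> //; first by lia.
    move=> m mab; have := zab (j.+1 + m); rewrite nth_prepend_one ifF ?ifF; try lia.
    by rewrite addKn; apply; lia.
  by move/gap; lia.
Qed.

Lemma leading_zeros t : 0 < last 0 t ->
  exists j s, t = nseq j 0 ++ s /\ 0 < head 0 s.
Proof.
elim: t => [|[|x] t IHt] //= lt; last by exists 0, (x.+1 :: t).
by have [j [s [-> hs]]] := IHt lt; exists j.+1, s.
Qed.

(** The number of zeros following a first part 1 is determined by the
composition: this makes prepending injective in both arguments. *)
Lemma nseq_cat_inj i j s t : 0 < head 0 s -> 0 < head 0 t ->
  nseq i 0 ++ s = nseq j 0 ++ t -> i = j /\ s = t.
Proof.
move=> hs ht; elim: i j => [|i IHi] [|j] //=.
- by move=> sE; rewrite sE in hs.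
- by move=> tE; rewrite -tE in ht.
- by case=> /IHi[-> ->].
Qed.

(** * Enumeration of the k-compositions of n + 1 *)

(** The index is shifted, so that the recursion starts from the only
k-composition of 1. *)
Fixpoint compositions (k n : nat) : seq (seq nat) :=
  if n is n'.+1 then
    map (incr_nth ^~ 0) (compositions k n') ++
    [seq prepend_one j s | j <- iota 0 k, s <- compositions k n']
  else [:: [:: 1]].

Lemma head_compositions k n s : s \in compositions k n -> 0 < head 0 s.
Proof.
case: n => [|n] /=; first by rewrite inE => /eqP->.
rewrite mem_cat => /orP[/mapP[t _ ->]|/allpairsP[p [_ _ ->]]] //.
by case: t.
Qed.

Lemma mem_compositions k n s : 0 < k ->
  s \in compositions k n <-> kcomposition k n.+1 s.
Proof.
move=> k0; elim: n s => [|n IHn] s.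
  rewrite inE; split=> [/eqP->|].
    by split=> // i j [/=]; lia.
  case: s => [|x s] [] //= sn hd ls _.
  (* A sum 1 with positive first part forces the other entries to vanish, so a
     positive last entry leaves only the first part. *)
  have [x1 s0] : x = 1 /\ sumn s = 0 by lia.
  rewrite x1 in ls *; case/lastP: s s0 ls {sn} => // s y.
  by rewrite sumn_rcons last_rcons; lia.
rewrite /= mem_cat; split.
  case/orP => [/mapP[t tc ->]|/allpairsP[[j t] /= [jk tc ->]]].
    have := head_compositions _ _ _ tc; move/IHn: tc.
    by case: t => [|[|x] t] //= tc _; apply/kcomposition_incr_head.
  apply/kcomposition_prepend_one => //; first exact: head_compositions tc.
  by split; [move: jk; rewrite mem_iota | apply/IHn].
case: s => [|[|[|x]] t] sc; [by case: sc | by case: sc | | ]; apply/orP; last first.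
  left; apply/mapP; exists (x.+1 :: t) => //.
  exact/IHn/kcomposition_incr_head.
right; case: t => [|y t] in sc *.
  by case: sc; case: n {IHn}.
have [_ _ lt _] := sc; have [//|j [u [tE hu]]] := leading_zeros (y :: t).
rewrite tE -/(prepend_one j u) in sc *.
have /kcomposition_prepend_one[//|//|jk uc] := sc.
by apply/allpairsP; exists (j, u); split; rewrite ?mem_iota //; apply/IHn.
Qed.

Lemma uniq_compositions k n : uniq (compositions k n).
Proof.
elim: n => //= n IHn; rewrite cat_uniq; apply/and3P; split.
- rewrite map_inj_in_uniq // => s t /head_compositions + /head_compositions.
  by case: s t => [|x s] [|y t] //= _ _ [-> ->].
- (* Incrementing a positive first part never gives 1. *)
  apply/hasPn => s /allpairsP[p [_ _ ->]]; apply/mapP => -[t].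
  by move/head_compositions; case: t => [|[|x] t].
- apply: allpairs_uniq => //; first exact: iota_uniq.
  move=> [j s] [i t] /allpairsP[p [_ ps [-> ->]]] /allpairsP[q [_ qt [-> ->]]].
  move: p.1 q.1 p.2 q.2 ps qt => {}j {}i {}s {}t.
  move=> /head_compositions hs /head_compositions ht [].
  by move=> /nseq_cat_inj-/(_ hs ht)[-> ->].
Qed.

(** * The polynomial counting k-compositions by zeros *)

Local Open Scope ring_scope.

Definition zeros_poly (k n : nat) : {poly nat} :=
  \sum_(s <- compositions k n) 'X^(count_mem 0%N s).

Lemma coef_zeros_poly k n l : (0 < k)%N ->
  (zeros_poly k n)`_l = c0 k n.+1 l%:Z.
Proof.
move=> k0; set p := fun s : seq nat => count_mem 0%N s == l.
have -> : (zeros_poly k n)`_l = count p (compositions k n).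
  rewrite /zeros_poly; elim: (compositions k n) => [|s r IHr].
    by rewrite big_nil coef0.
  by rewrite big_cons coefD coefXn IHr /p /= eq_sym natn.
have -> : c0 k n.+1 l%:Z = #|` [fset s in filter p (compositions k n)]|%fset.
  rewrite /=; congr (size _); congr enum_fset; apply/fsetP => s.
  rewrite in_fset_set; last exact: finite_kcompositions_zeros.
  rewrite !inE mem_filter; apply/idP/idP.
    by rewrite in_setE => -[/mem_compositions -> // sl]; rewrite andbT; apply/eqP.
  by case/andP => /eqP sl /mem_compositions sc; rewrite in_setE; split=> //; apply: sc.
by rewrite card_fseq undup_id ?filter_uniq ?uniq_compositions // size_filter.
Qed.

(** The summand 1 comes from the compositions with first part at least 2, and
the summand 'X^j from those with first part 1 followed by j zeros. *)
Lemma zeros_polyS k n :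
  zeros_poly k n.+1 = (1 + \sum_(j < k) 'X^j) * zeros_poly k n.
Proof.
rewrite /zeros_poly /= big_cat big_map mulrDl mul1r; congr (_ + _).
  apply: eq_big_seq => s /head_compositions.
  by case: s => [|[|x] s].
rewrite big_allpairs_dep big_distrl /= -(big_mkord xpredT (fun j : nat =>
  'X^j * \sum_(s <- compositions k n) 'X^(count_mem 0%N s))) /=.
rewrite /index_iota subn0; apply: eq_bigr => j _.
rewrite big_distrr /=; apply: eq_bigr => s _.
by rewrite -exprD /= count_cat count_nseq mul1n.
Qed.

Lemma zeros_polyE k n :
  zeros_poly k n = (1 + \sum_(j < k) 'X^j) ^+ n.
Proof.
elim: n => [|n IHn]; first by rewrite /zeros_poly big_seq1.
by rewrite zeros_polyS IHn exprS.
Qed.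

Local Close Scope ring_scope.

Theorem proposition6 (k : nat) (hk : 1 <= k) :
  (forall n l : nat, 2 <= n ->
     c0 k n l%:Z
     = 2 * c0 k (n - 1) l%:Z
       + \sum_(1 <= j < k) c0 k (n - 1) (l%:Z - j%:Z)%R) /\
  (forall n l : nat, 1 <= n ->
     c0 k n l%:Z
     = \sum_(0 <= m < n) 'C(n - 1, m) * polynomial_coef m l (k - 1)).
Proof.
split=> [[|[|n]] // l _|[|n] // l _]; rewrite subn1 succnK -coef_zeros_poly //.
  have coefXM j : (('X^j * zeros_poly k n)`_l)%R = c0 k n.+1 (l%:Z - j%:Z)%R.
    rewrite coefXnM; case: ltnP => lj.
      by have -> : (l%:Z - j%:Z)%R = Negz (j - l.+1) by lia.
    by rewrite subzn // -coef_zeros_poly.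
  rewrite zeros_polyS mulrDl mul1r coefD coef_zeros_poly // mulr_suml coef_sum.
  transitivity (c0 k n.+1 l%:Z + \sum_(0 <= j < k) c0 k n.+1 (l%:Z - j%:Z)%R).
    by rewrite big_mkord; congr (_ + _); apply: eq_bigr => j _; apply: coefXM.
  by rewrite big_ltn // subr0 mul2n -addnn addnA.
rewrite zeros_polyE exprDn coef_sum big_mkord; apply: eq_bigr => m _.
rewrite expr1n mul1r coefMn /polynomial_coef subn1 prednK //.
by rewrite -mulr_natr mulrC natn.
Qed.
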